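(* Let $q$ be an odd integer and $d\ge1$. Let $\mathcal{P}\subset\mathbb{Z}_q^d$ be a set of points and $\mathcal{S}$ a set of spheres with arbitrary radii in $\mathbb{Z}_q^d$. Then $$\left|I(\mathcal{P},\mathcal{S})-\frac{|\mathcal{P}||\mathcal{S}|}{q}\right|\le\sqrt{2\tau(q)}\,\frac{q^d}{\gamma(q)^{d/2}}\sqrt{|\mathcal{P}||\mathcal{S}|},$$ where $\gamma(q)$ is the smallest prime divisor of $q$ and $\tau(q)$ is the number of divisors of $q$.
   Context: $\mathbb{Z}_q=\mathbb{Z}/q\mathbb{Z}$. A sphere in $\mathbb{Z}_q^d$ with center $a=(a_1,\ldots,a_d)\in\mathbb{Z}_q^d$ and radius $r\in\mathbb{Z}_q$ is the set $\{x\in\mathbb{Z}_q^d:(x_1-a_1)^2+\cdots+(x_d-a_d)^2=r\}$; a set $\mathcal{S}$ of spheres is given as a set of distinct center–radius pairs. $I(\mathcal{P},\mathcal{S})$ is the number of pairs $(p,s)\in\mathcal{P}\times\mathcal{S}$ with $p\in s$. *)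

(* Defs.v *)
From mathcomp Require Import all_boot all_order all_algebra.
Set Implicit Arguments.
Unset Strict Implicit.
Unset Printing Implicit Defensive.
Import GRing.Theory.
Local Open Scope ring_scope.

(* ['Z_q] is the ring of integers mod [q] only when [1 < q]. *)
Definition sphere (q d : nat) (a : 'rV['Z_q]_d) (r : 'Z_q) :
    {set 'rV['Z_q]_d} :=
  [set x : 'rV['Z_q]_d | \sum_(i < d) (x 0 i - a 0 i) ^+ 2 == r].

(* Spheres are represented by (center, radius): distinct pairs are counted
   separately even when they define the same set of points. *)
Definition incidences (q d : nat) (P : {set 'rV['Z_q]_d})
    (S : {set 'rV['Z_q]_d * 'Z_q}) : nat :=
  #|[set ps in setX P S | ps.1 \in sphere ps.2.1 ps.2.2]|.

Definition tau (q : nat) : nat := size (divisors q).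

(* Main.v *)
Require Import Defs.
From mathcomp Require Import all_boot all_order all_algebra.
From mathcomp Require Import fingroup cyclic ring lra.
From mathcomp Require Import reals exp.
Import Order.TTheory GRing.Theory Num.Theory.
Local Open Scope ring_scope.

(* By Cauchy-Schwarz over all spheres [(a, r)], the squared discrepancy is at
   most [|S|] times the variance of [N(a, r)], the number of points of [P] on the
   sphere. The second moment of [N] counts triples [(p, p', a)] with [a]
   equidistant from [p] and [p']; since [2] is invertible, for fixed [p, p'] this
   is the number of [b] orthogonal to [u = p - p']. If [b |-> b . u] has image of
   size [m], a divisor of [q], there are [q^d / m] such [b]: the value [m = q]
   gives the main term, and otherwise [m <= q / gamma q] and [u] is killed by
   [m], which happens for only [m^d] vectors [u]. *)

(** * Orthogonality and torsion in ['rV['Z_q]_d] *)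

Definition dot {q d : nat} (b u : 'rV['Z_q]_d) : 'Z_q :=
  \sum_(i < d) b 0 i * u 0 i.

Definition perp {q d : nat} (u : 'rV['Z_q]_d) : {set 'rV['Z_q]_d} :=
  [set b | dot b u == 0].

Lemma dotDl q d (b c u : 'rV['Z_q]_d) : dot (b + c) u = dot b u + dot c u.
Proof. by rewrite -big_split; apply: eq_bigr => i _; rewrite mxE mulrDl. Qed.

Lemma dotBl q d (b c u : 'rV['Z_q]_d) : dot (b - c) u = dot b u - dot c u.
Proof. by rewrite -sumrB; apply: eq_bigr => i _; rewrite !mxE mulrBl. Qed.

Lemma dot_delta q d (u : 'rV['Z_q]_d) (i : 'I_d) : dot (delta_mx 0 i) u = u 0 i.
Proof.
rewrite /dot (bigD1 i) //= big1 ?addr0 ?mxE ?eqxx ?mul1r // => j ji.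
by rewrite mxE eqxx (negPf ji) mul0r.
Qed.

Lemma card_rV_Zq {q} (d : nat) : (1 < q)%N -> #|{: 'rV['Z_q]_d}| = (q ^ d)%N.
Proof. by move=> q1; rewrite card_mx card_ord Zp_cast // mul1n. Qed.

Lemma group_set_dot_image {q d} (u : 'rV['Z_q]_d) :
  group_set [set dot b u | b in [set: 'rV['Z_q]_d]].
Proof.
apply/group_setP; split.
  apply/imsetP; exists 0; rewrite ?inE //.
  by rewrite /dot big1 // => i _; rewrite mxE mul0r.
move=> _ _ /imsetP[b _ ->] /imsetP[c _ ->].
by apply/imsetP; exists (b + c); rewrite ?inE // dotDl.
Qed.

(** The witness [m] is the order of the image of [b |-> dot b u], a subgroup of ['Z_q]. Each
    coordinate of [u] is the image of a basis vector, so it is killed by this order. *)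
Lemma card_perp_torsion (q d : nat) (u : 'rV['Z_q]_d) : (1 < q)%N ->
  exists m, [/\ (m %| q)%N, (#|perp u| * m = q ^ d)%N & forall i, u 0 i *+ m = 0].
Proof.
move=> q1; pose G := Group (group_set_dot_image u).
exists #|G|; split.
- by have := cardSg (subsetT G); rewrite cardsT card_ord Zp_cast.
- rewrite -(card_rV_Zq d q1) mulnC -[RHS]sum1_card.
  rewrite (partition_big (fun b => dot b u) (fun y => y \in G)) /=; last first.
    by move=> b _; apply/imsetP; exists b; rewrite ?inE.
  rewrite -sum_nat_const; apply: eq_bigr => _ /imsetP[c _ ->].
  (* The fiber through [c] is the translate of [perp u] by [c], so all fibers have equal size. *)
  rewrite sum1_card -(card_preimset (perp u) (f := fun b => b - c)); last first.
    exact: addIr.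
  by apply: eq_card => b; rewrite !inE dotBl subr_eq0.
- move=> i; have: u 0 i \in G.
    by rewrite -dot_delta; apply/imsetP; exists (delta_mx 0 i); rewrite ?inE.
  by move/expg_cardG; rewrite FinRing.zmodXgE.
Qed.

(** If [q] divides [y * m], then [y] is a multiple [k * (q %/ m)], and [y < q] forces [k < m]. *)
Lemma card_torsion_Zq (q m : nat) : (1 < q)%N -> (m %| q)%N ->
  (#|[set y : 'Z_q | (y *+ m == 0)%R]| <= m)%N.
Proof.
move=> q1 mq; have q0 : (0 < q)%N by exact: ltnW.
have m0 : (0 < m)%N := dvdn_gt0 q0 mq.
rewrite -[leqRHS]card_ord -cardsT.
apply: leq_trans (leq_imset_card (fun i : 'I_m => inZp (i * (q %/ m))%N : 'Z_q) _).
apply/subset_leq_card/subsetP => y; rewrite inE -mulr_natr => /eqP ym0.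
have yq : (y < q)%N by rewrite -[ltnRHS](Zp_cast q1).
have /dvdnP[k yE] : (q %/ m %| y)%N.
  rewrite -(dvdn_pmul2r m0) divnK //.
  have /(congr1 (@nat_of_ord _)) : (y * m)%:R = 0 :> 'Z_q by rewrite natrM natr_Zp.
  by rewrite val_Zp_nat // => /eqP.
have km : (k < m)%N.
  have qm0 : (0 < q %/ m)%N by rewrite divn_gt0 // dvdn_leq.
  by rewrite -(ltn_pmul2r qm0) -yE [ltnRHS]mulnC divnK.
apply/imsetP; exists (Ordinal km); rewrite ?inE //.
by apply: val_inj; rewrite /= -yE modn_small ?ltn_ord.
Qed.

Definition torsion_rV (q d m : nat) : {set 'rV['Z_q]_d} :=
  [set u : 'rV['Z_q]_d | [forall i, u 0 i *+ m == 0]].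

Lemma card_torsion_rV (q d m : nat) : (1 < q)%N -> (m %| q)%N ->
  (#|torsion_rV q d m| <= m ^ d)%N.
Proof.
move=> q1 mq; pose A := [set y : 'Z_q | y *+ m == 0].
pose f (u : 'rV['Z_q]_d) := [ffun i => u 0 i].
have f_inj : injective f.
  move=> u v /ffunP fuv; apply/rowP => i.
  by have := fuv i; rewrite !ffunE.
rewrite -(card_imset _ f_inj).
apply: (@leq_trans (#|A| ^ #|'I_d|)%N).
  rewrite -card_ffun_on; apply/subset_leq_card/subsetP => _ /imsetP[u + ->]; rewrite inE => /forallP uA.
  by apply/ffun_onP => i; rewrite ffunE inE.
rewrite card_ord.
case: d {f f_inj} => [|d]; first by rewrite !expn0.
by rewrite leq_exp2r // card_torsion_Zq.
Qed.

(** The image size [m] depends on [u]; summing over every proper divisor that could occur gives a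
    bound whose sum over [u] can be taken one [m] at a time. *)
Lemma card_perp_le (q d : nat) (u : 'rV['Z_q]_d.+1) : (1 < q)%N ->
  (#|perp u| <= q ^ d + \sum_(m <- divisors q | m < q)
                          if u \in torsion_rV q d.+1 m then q ^ d.+1 %/ m else 0)%N.
Proof.
move=> q1; have q0 : (0 < q)%N by exact: ltnW.
have [m [mq Km um]] := card_perp_torsion _ _ u q1.
have m0 : (0 < m)%N := dvdn_gt0 q0 mq.
have [qm|mq'] := leqP q m.
  have {qm}mE : m = q by apply/eqP; rewrite eqn_leq qm dvdn_leq.
  apply: leq_trans (leq_addr _ _); move: Km; rewrite mE expnSr => /eqP.
  by rewrite eqn_pmul2r // => /eqP->.
rewrite (big_rem m) /=; last by rewrite -dvdn_divisors.
have -> : u \in torsion_rV q d.+1 m.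
  by rewrite inE; apply/forallP => i; rewrite um.
by rewrite mq' -Km mulnK // addnCA leq_addr.
Qed.

(** For a proper divisor [m], at most [m ^ d.+1] points [p'] contribute, each [q ^ d.+1 %/ m]. The
    product is [q ^ d.+1 * m ^ d], largest at [m = q %/ pdiv q]. *)
Lemma sum_perp_le (q d : nat) (V : {set 'rV['Z_q]_d.+1}) p : (1 < q)%N ->
  (\sum_(p' in V) #|perp (p - p')| <=
     #|V| * q ^ d + tau q * (q ^ d.+1 * (q %/ pdiv q) ^ d))%N.
Proof.
move=> q1; have q0 : (0 < q)%N by exact: ltnW.
apply: leq_trans (leq_sum _ (fun p' _ => card_perp_le _ _ (p - p') q1)) _.
rewrite big_split /= sum_nat_const leq_add2l exchange_big /=.
have -> : (tau q * (q ^ d.+1 * (q %/ pdiv q) ^ d) =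
    \sum_(m <- divisors q) q ^ d.+1 * (q %/ pdiv q) ^ d)%N.
  by rewrite big_const_seq count_predT iter_addn_0 mulnC.
rewrite big_mkcond /= big_seq [leqRHS]big_seq; apply: leq_sum => m.
rewrite -dvdn_divisors // => mq; case: ifP => // mq'.
have m0 : (0 < m)%N := dvdn_gt0 q0 mq.
rewrite -big_mkcondr /= sum_nat_const.
apply: (@leq_trans (m ^ d.+1 * (q ^ d.+1 %/ m))%N).
  rewrite leq_mul2r; apply/orP; right.
  apply: leq_trans (card_torsion_rV _ _ _ q1 mq).
  have inj : injective (fun p' => p - p') by move=> x y /addrI/oppr_inj.
  rewrite -(card_imset _ inj); apply/subset_leq_card/subsetP => _ /imsetP[p' + ->].
  by case/andP.
have mq'' : (m %| q ^ d.+1)%N by rewrite expnS dvdn_mulr.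
rewrite [(m ^ _)%N]expnS mulnAC [X in (X * _)%N]mulnC divnK //.
rewrite leq_mul2l; apply/orP; right.
case: d {V p mq''} => [|d]; first by rewrite !expn0.
rewrite leq_exp2r // leq_divRL ?pdiv_gt0 ?pdiv_dvd //.
(* The claim becomes [pdiv q <= q %/ m], where [q %/ m] is a divisor of [q] greater than 1. *)
rewrite -{2}(divnK mq) mulnC leq_mul2r; apply/orP; right.
apply: pdiv_min_dvd; first by rewrite ltn_divRL ?mul1n.
by rewrite -{2}(divnK mq) dvdn_mulr.
Qed.

(** * Equidistant centers and moments of the sphere counts *)

Definition sqdist {q d : nat} (a x : 'rV['Z_q]_d) : 'Z_q :=
  \sum_(i < d) (x 0 i - a 0 i) ^+ 2.

(** The difference of the two squared distances factors as [dot (p + p' - 2a) (p - p')], and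
    [a |-> p + p' - 2a] is injective because 2 is a unit for odd [q]. *)
Lemma card_equidistant (q d : nat) (p p' : 'rV['Z_q]_d) : (1 < q)%N -> odd q ->
  (#|[set a | sqdist a p == sqdist a p']| <= #|perp (p - p')|)%N.
Proof.
move=> q1 q_odd.
have unit2 : (2%:R : 'Z_q) \is a GRing.unit by rewrite unitZpE // coprimen2.
pose f (a : 'rV['Z_q]_d) := p + p' - 2%:R *: a.
have f_inj : injective f.
  move=> a b /addrI/oppr_inj/rowP ab; apply/rowP => i; apply: (mulrI unit2).
  by have := ab i; rewrite !mxE.
rewrite -(card_imset _ f_inj); apply/subset_leq_card/subsetP => _ /imsetP[a + ->].
rewrite !inE -subr_eq0 => /eqP aE; rewrite -[X in _ == X]aE /dot -sumrB.
by apply/eqP/eq_bigr => i _; rewrite !mxE; ring.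
Qed.

Lemma sum_sqr_card_fiber (T I : finType) (P : {set T}) (f : T -> I) :
  (\sum_r #|[set p in P | f p == r]| ^ 2 =
   \sum_(p in P) \sum_(p' in P) (f p == f p'))%N.
Proof.
rewrite [RHS](partition_big f predT) //=; apply: eq_bigr => r _.
rewrite -mulnn -sum_nat_const; apply: eq_big => [p|p]; first by rewrite inE.
rewrite inE => /andP[_ /eqP->]; rewrite -sum1_card big_mkcond [RHS]big_mkcond /=.
by apply: eq_bigr => p' _; rewrite inE eq_sym; case: (p' \in P) => //=; case: eqP.
Qed.

Definition on_sphere {q d : nat} (P : {set 'rV['Z_q]_d}) (s : 'rV['Z_q]_d * 'Z_q) :=
  [set p in P | sqdist s.1 p == s.2].

(** For each center, a point lies on the sphere of exactly one radius. *)
Lemma sum_card_on_sphere (q d : nat) (P : {set 'rV['Z_q]_d}) : (1 < q)%N ->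
  (\sum_s #|on_sphere P s| = #|P| * q ^ d)%N.
Proof.
move=> q1; rewrite -(pair_bigA _ (fun a r => #|on_sphere P (a, r)|)) /=.
rewrite -(card_rV_Zq d q1) mulnC -sum_nat_const; apply: eq_bigr => a _.
rewrite -[RHS]sum1_card (partition_big (sqdist a) predT) //=.
by apply: eq_bigr => r _; rewrite -sum1_card; apply: eq_bigl => p; rewrite inE.
Qed.

Lemma sum_sqr_card_on_sphere (q d : nat) (P : {set 'rV['Z_q]_d.+1}) :
  (1 < q)%N -> odd q ->
  (\sum_s #|on_sphere P s| ^ 2 <=
     #|P| * (#|P| * q ^ d + tau q * (q ^ d.+1 * (q %/ pdiv q) ^ d)))%N.
Proof.
move=> q1 q_odd; rewrite -(pair_bigA _ (fun a r => #|on_sphere P (a, r)| ^ 2)%N) /=.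
under eq_bigr => a _ do rewrite (sum_sqr_card_fiber _ _ P (sqdist a)).
rewrite exchange_big /= -sum_nat_const; apply: leq_sum => p _.
rewrite exchange_big /=; apply: leq_trans (sum_perp_le _ _ P p q1).
apply: leq_sum => p' _; apply: leq_trans (card_equidistant _ _ p p' q1 q_odd).
by rewrite -sum1_card [leqRHS]big_mkcond leq_sum //= => a _; rewrite inE; case: eqP.
Qed.

(** * From the second moment to the discrepancy *)

Lemma incidencesE (q d : nat) (P : {set 'rV['Z_q]_d})
    (S : {set 'rV['Z_q]_d * 'Z_q}) :
  incidences P S = (\sum_(s in S) #|on_sphere P s|)%N.
Proof.
under eq_bigr => s _ do rewrite -sum1_card.
rewrite (exchange_big_dep (mem P)) /=; last by move=> s p _; rewrite inE => /andP[].
rewrite pair_big_dep /= /incidences -sum1_card; apply: eq_bigl => -[p s] /=.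
by rewrite !inE /=; case: (p \in P); case: (s \in S).
Qed.

(** Cauchy-Schwarz against the constant 1, read off from the nonnegative sum of the squares of
    [n * f s - A]. *)
Lemma sqr_sum_le (R : realFieldType) (T : finType) (S : {set T}) (f : T -> R) :
  (\sum_(s in S) f s) ^+ 2 <= #|S|%:R * \sum_(s in S) f s ^+ 2.
Proof.
set A := \sum_(s in S) f s; set n := #|S|%:R.
have [/cards0_eq S0|n0] := posnP #|S|.
  by rewrite /A S0 !big_set0 mulr0 expr0n.
have : 0 <= \sum_(s in S) (n * f s - A) ^+ 2 by apply: sumr_ge0 => s _; rewrite sqr_ge0.
have -> : \sum_(s in S) (n * f s - A) ^+ 2 =
    n * (n * (\sum_(s in S) f s ^+ 2) - A ^+ 2).
  rewrite (eq_bigr (fun s => n ^+ 2 * f s ^+ 2 - 2 * n * A * f s + A ^+ 2));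
    last by move=> s _; ring.
  rewrite big_split sumrB -!mulr_sumr sumr_const -/A -mulr_natr -/n /=; ring.
by rewrite pmulr_rge0 ?ltr0n // subr_ge0.
Qed.

Lemma incidence_discrepancy_sqr_le (R : realFieldType) (q d : nat)
    (P : {set 'rV['Z_q]_d.+1}) (S : {set 'rV['Z_q]_d.+1 * 'Z_q}) :
  (1 < q)%N -> odd q ->
  ((incidences P S)%:R - #|P|%:R * #|S|%:R / q%:R) ^+ 2
    <= #|S|%:R * (#|P|%:R * ((tau q)%:R * (q%:R ^+ d.+1 * (q%:R / (pdiv q)%:R) ^+ d)))
    :> R.
Proof.
move=> q1 q_odd; have q0 : (q%:R : R) != 0 by rewrite pnatr_eq0 -lt0n ltnW.
(* [c] is the mean of [#|on_sphere P s|] over all [q ^ d.+2] pairs [s]. *)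
set c : R := #|P|%:R / q%:R.
have -> : (incidences P S)%:R - #|P|%:R * #|S|%:R / q%:R =
    \sum_(s in S) (#|on_sphere P s|%:R - c).
  rewrite sumrB sumr_const incidencesE natr_sum /c; congr (_ - _).
  by rewrite mulrAC mulr_natr.
apply: le_trans (sqr_sum_le _ _ _ _) _; rewrite ler_wpM2l //.
apply: (@le_trans _ _ (\sum_s (#|on_sphere P s|%:R - c) ^+ 2)).
  by rewrite [leRHS](bigID (mem S)) /= lerDl sumr_ge0 // => s _; rewrite sqr_ge0.
have -> : \sum_s (#|on_sphere P s|%:R - c) ^+ 2 =
    (\sum_s #|on_sphere P s| ^ 2)%:R - #|P|%:R ^+ 2 * q%:R ^+ d.
  rewrite (eq_bigr (fun s => (#|on_sphere P s| ^ 2)%:R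
    - 2 * c * #|on_sphere P s|%:R + c ^+ 2)); last by move=> s _; rewrite natrX; ring.
  rewrite big_split sumrB -mulr_sumr -!natr_sum /= sum_card_on_sphere //.
  have cardT : #|{: 'rV['Z_q]_d.+1 * 'Z_q}| = (q ^ d.+1 * q)%N.
    by rewrite card_prod card_rV_Zq // card_ord Zp_cast.
  rewrite sumr_const cardT -[c ^+ 2 *+ _]mulr_natr.
  by rewrite !natrM !natrX /c exprS; field.
(* The subtracted square of the mean cancels the main term of the second moment exactly. *)
rewrite lerBlDr; have := sum_sqr_card_on_sphere _ _ P q1 q_odd.
rewrite -(ler_nat R) => /le_trans; apply.
rewrite mulnDr natrD !natrM !natrX natf_div ?pdiv_dvd // addrC.
by rewrite lerD // mulrA expr2.
Qed.

Theorem theorem1p3 (R : realType) (q d : nat) (q_gt1 : (1 < q)%N)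
    (q_odd : odd q) (d_ge1 : (1 <= d)%N) (P : {set 'rV['Z_q]_d})
    (S : {set 'rV['Z_q]_d * 'Z_q}) :
  `| (incidences P S)%:R - #|P|%:R * #|S|%:R / q%:R |
    <= Num.sqrt (2 * (tau q)%:R)
       * (q%:R ^+ d / powR (pdiv q)%:R (d%:R / 2))
       * Num.sqrt (#|P|%:R * #|S|%:R) :> R.
Proof.
(* With the dimension written [d.+1], the exponent [d] below stands for the dimension minus one. *)
case: d d_ge1 P S => // d _ P S.
have g0 : (0 : R) < (pdiv q)%:R by rewrite ltr0n pdiv_gt0.
rewrite -ler_sqr ?nnegrE ?mulr_ge0 ?invr_ge0 ?exprn_ge0 ?powR_ge0 ?sqrtr_ge0 //.
rewrite real_normK ?num_real // !exprMn !sqr_sqrtr ?mulr_ge0 //.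
have -> : (powR (pdiv q)%:R (d.+1%:R / 2) : R)^-1 ^+ 2 = (pdiv q)%:R^-1 ^+ d.+1.
  rewrite exprVn -powR_mulrn ?powR_ge0 // -powRrM divfK ?pnatr_eq0 //.
  by rewrite powR_mulrn ?ltW // exprVn.
apply: le_trans (incidence_discrepancy_sqr_le _ _ _ P S q_gt1 q_odd) _.
set x : R := q%:R; set g : R := (pdiv q)%:R.
(* The squared target exceeds the bound already obtained by the factor [2 * (x / g)], so this
   inequality suffices. *)
have xg1 : 1 <= x / g.
  by rewrite ler_pdivlMr // mul1r ler_nat dvdn_leq ?pdiv_dvd // ltnW.
have -> : 2 * (tau q)%:R * ((x ^+ d.+1) ^+ 2 * g^-1 ^+ d.+1) * (#|P|%:R * #|S|%:R) =
    #|S|%:R * (#|P|%:R * ((tau q)%:R * (x ^+ d.+1 * (2 * (x / g) ^+ d.+1)))).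
  by rewrite exprMn; ring.
rewrite !ler_wpM2l ?exprn_ge0 //.
have xd : 0 <= (x / g) ^+ d by rewrite exprn_ge0 // (le_trans ler01).
rewrite exprS mulrA ler_peMl //; lra.
Qed.
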